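(* Let $\omega(x,y,z) = x(y\circ z)$ with $u\circ v=\tfrac12(uv+vu)$ (the Jordan family, $q=1$). Then: (i) a basis of $U(A^\omega)$ consists of $1, a, b, a^2, ab, ba, b^2, a^2b, bab$; (ii) the structure constants are $a\cdot a = a^2$, $a\cdot b = ab$, $a\cdot ab = a^2b$, $a\cdot ba = a-a^2b$, $a\cdot bab = ab$, $b\cdot a = ba$, $b\cdot b = b^2$, $b\cdot ab = bab$, $b\cdot ba = b-bab$, $b\cdot bab = b^2$, $a^2\cdot b = a^2b$, $a^2\cdot ba = a^2$, $a^2\cdot bab = a^2b$, $ab\cdot a = a-a^2b$, $ab\cdot ab = ab$, $ba\cdot b = bab$, $ba\cdot ba = ba$, $ba\cdot bab = bab$, $b^2\cdot a = b-bab$, $b^2\cdot ab = b^2$, $a^2b\cdot a = a^2$, $a^2b\cdot ab = a^2b$, $bab\cdot a = ba$, $bab\cdot ab = bab$, where all products of two basis elements different from $1$ that are not listed are $0$; (iii) the Wedderburn decomposition is $U(A^\omega) = \mathfrak{R}\oplus \mathbb{F}\oplus M_2(\mathbb{F})$, where $\mathfrak{R}$ is the radical, of dimension $4$; that is, as a vector space $U(A^\omega)$ is the direct sum of $\mathfrak{R}$ and a subalgebra isomorphic to $U(A^\omega)/\mathfrak{R}\cong \mathbb{F}\oplus M_2(\mathbb{F})$; (iv) up to isomorphism, $U(A^\omega)$ has exactly two finite dimensional irreducible representations.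
   Context: $\mathbb{F}$ is a field of characteristic $0$. $A$ is the 2-dimensional space of $2\times 2$ matrices over $\mathbb{F}$ with zero diagonal, with basis $e_1 = \begin{bmatrix} 0&1\\0&0\end{bmatrix}$, $e_2 = \begin{bmatrix} 0&0\\1&0\end{bmatrix}$; it is closed under triple products $xyz$ of matrices. For a trilinear operation $\omega(x,y,z)$ (a fixed rational linear combination of the six products of $x,y,z$ in all orders), $A^\omega$ denotes the space $A$ with the trilinear operation $\omega$ computed using matrix multiplication. Let $\mathbb{F}\langle a,b\rangle$ be the free unital associative algebra and $\phi\colon A \to \mathbb{F}\langle a,b\rangle$ the linear map with $\phi(e_1)=a$, $\phi(e_2)=b$. The universal associative envelope is $U(A^\omega) = \mathbb{F}\langle a,b\rangle / I$, where $I$ is the two-sided ideal generated by the elements $\omega(\phi(x),\phi(y),\phi(z)) - \phi(\omega(x,y,z))$ for $x,y,z\in\{e_1,e_2\}$. The cosets of $a,b$ in $U(A^\omega)$ are again written $a,b$. Representations of $U(A^\omega)$ are unital algebra homomorphisms to endomorphism algebras. *)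

(* Defs.v *)
From HB Require Import structures.
From mathcomp Require Import all_boot all_algebra.
From mathcomp Require Import boolp.
From mathcomp.multinomials Require Import monalg.

Set Implicit Arguments.
Unset Strict Implicit.
Unset Printing Implicit Defensive.

Import GRing.Theory.
Local Open Scope ring_scope.
Local Open Scope quotient_scope.

(* [ideal2 R] : proper two-sided ideals. The library's [idealr] is a proper
   additive subgroup stable under left multiplication by arbitrary elements.
   An ideal of a unital algebra is automatically stable under scalars. *)
HB.mixin Record isRightStable (R : nzRingType) (S : R -> bool) := {
  right_stable_subproof : forall a, {in S, forall u, u * a \in S}
}.

#[short(type="ideal2")]
HB.structure Definition Ideal2 (R : nzRingType) :=
  {S of Idealr R S & isRightStable R S}.

Lemma ideal2Ml (R : nzRingType) (I : ideal2 R) (a u : R) :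
  u \in (I : {pred R}) -> a * u \in (I : {pred R}).
Proof. exact: idealMr. Qed.

Lemma ideal2Mr (R : nzRingType) (I : ideal2 R) (a u : R) :
  u \in (I : {pred R}) -> u * a \in (I : {pred R}).
Proof. exact: right_stable_subproof. Qed.

(* The quotient of an algebra by a proper two-sided ideal; the library only
   equips quotients of commutative rings with a ring structure. *)
Definition algquot (F : fieldType) (A : algType F) (I : ideal2 A) : Type :=
  Quotient.quot I.
HB.instance Definition _ (F : fieldType) (A : algType F) (I : ideal2 A) :=
  GRing.Zmodule.on (algquot I).
HB.instance Definition _ (F : fieldType) (A : algType F) (I : ideal2 A) :
    EqQuotient A (Quotient.equiv I) (algquot I) :=
  EqQuotient.on (algquot I).

(* The operations are locked, here and below, because conversion between
   distinct elements would otherwise unfold the underlying finite maps. *)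
HB.lock Definition qclass (F : fieldType) (A : algType F) (I : ideal2 A)
  (x : A) : algquot I := \pi_(Quotient.quot I) x.

HB.lock Definition qmul (F : fieldType) (A : algType F) (I : ideal2 A)
    (u v : algquot I) : algquot I :=
  qclass I (repr (u : Quotient.quot I) * repr (v : Quotient.quot I)).

HB.lock Definition qscale (F : fieldType) (A : algType F) (I : ideal2 A)
    (c : F) (u : algquot I) : algquot I :=
  qclass I (c *: repr (u : Quotient.quot I)).

Section AlgQuotient.
Variables (F : fieldType) (A : algType F) (I : ideal2 A).
Local Notation Ip := (I : {pred A}).
Local Notation algquot := (algquot I).
Local Notation qclass := (qclass I).
Local Notation qmul := (@qmul F A I).
Local Notation qscale := (@qscale F A I).

Lemma qclassP (x y : A) : reflect (qclass x = qclass y) (x - y \in Ip).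
Proof. by rewrite qclass.unlock (Quotient.idealrBE I); exact: eqP. Qed.

Lemma qclass_surj (u : algquot) : exists x, u = qclass x.
Proof. by exists (repr (u : Quotient.quot I)); rewrite qclass.unlock reprK. Qed.

Lemma qclass_repr (x : A) : x - repr (qclass x : Quotient.quot I) \in Ip.
Proof. by apply/qclassP; rewrite qclass.unlock reprK. Qed.

Lemma qclassB : zmod_morphism qclass.
Proof.
move=> x y; rewrite qclass.unlock.
exact: (pi_is_zmod_morphism (Quotient.quot I)).
Qed.
HB.instance Definition _ :=
  GRing.isZmodMorphism.Build A algquot qclass qclassB.

Lemma qmulE x y : qmul (qclass x) (qclass y) = qclass (x * y).
Proof.
rewrite qmul.unlock; apply/esym/qclassP.
set y' := repr (qclass y : Quotient.quot I).
rewrite -[x * y](subrK (x * y')) -mulrBr -addrA -mulrBl.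
apply: (@rpredD A I); first by apply: ideal2Ml; exact: qclass_repr.
by apply: ideal2Mr; exact: qclass_repr.
Qed.

Lemma qscaleE c x : qscale c (qclass x) = qclass (c *: x).
Proof.
rewrite qscale.unlock; apply/esym/qclassP.
rewrite -scalerBr -[_ - _]mul1r scalerAl.
by apply: ideal2Ml; exact: qclass_repr.
Qed.

Let q1 : algquot := qclass 1.

Lemma qmulA : associative qmul.
Proof.
move=> u v w; have [x ->] := qclass_surj u; have [y ->] := qclass_surj v.
by have [z ->] := qclass_surj w; rewrite !qmulE mulrA.
Qed.
Lemma qmul1l : left_id q1 qmul.
Proof. by move=> u; have [x ->] := qclass_surj u; rewrite qmulE mul1r. Qed.
Lemma qmul1r : right_id q1 qmul.
Proof. by move=> u; have [x ->] := qclass_surj u; rewrite qmulE mulr1. Qed.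
Lemma qmulDl : left_distributive qmul +%R.
Proof.
move=> u v w; have [x ->] := qclass_surj u; have [y ->] := qclass_surj v.
by have [z ->] := qclass_surj w; rewrite -raddfD !qmulE -raddfD mulrDl.
Qed.
Lemma qmulDr : right_distributive qmul +%R.
Proof.
move=> u v w; have [x ->] := qclass_surj u; have [y ->] := qclass_surj v.
by have [z ->] := qclass_surj w; rewrite -raddfD !qmulE -raddfD mulrDr.
Qed.
Lemma q1_neq0 : q1 != 0.
Proof.
by apply/eqP; rewrite -(raddf0 qclass) => /qclassP; rewrite subr0 idealr1.
Qed.
HB.instance Definition _ := GRing.Zmodule_isNzRing.Build algquot
  qmulA qmul1l qmul1r qmulDl qmulDr q1_neq0.

Lemma qscaleA a b v : qscale a (qscale b v) = qscale (a * b) v.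
Proof. by have [x ->] := qclass_surj v; rewrite !qscaleE scalerA. Qed.
Lemma qscale1 : left_id 1 qscale.
Proof. by move=> v; have [x ->] := qclass_surj v; rewrite qscaleE scale1r. Qed.
Lemma qscaleDr : right_distributive qscale +%R.
Proof.
move=> a u v; have [x ->] := qclass_surj u; have [y ->] := qclass_surj v.
by rewrite -raddfD !qscaleE -raddfD scalerDr.
Qed.
Lemma qscaleDl v : {morph qscale^~ v : a b / a + b}.
Proof.
by move=> a b; have [x ->] := qclass_surj v; rewrite !qscaleE -raddfD scalerDl.
Qed.
HB.instance Definition _ := GRing.Zmodule_isLmodule.Build F algquot
  qscaleA qscale1 qscaleDr qscaleDl.

Lemma qscaleAl (c : F) (u v : algquot) : c *: (u * v) = c *: u * v.
Proof.
have [x ->] := qclass_surj u; have [y ->] := qclass_surj v.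
by rewrite /GRing.mul /GRing.scale /= qmulE !qscaleE qmulE scalerAl.
Qed.
HB.instance Definition _ := GRing.Lmodule_isLalgebra.Build F algquot qscaleAl.
Lemma qscaleAr (c : F) (u v : algquot) : c *: (u * v) = u * (c *: v).
Proof.
have [x ->] := qclass_surj u; have [y ->] := qclass_surj v.
by rewrite /GRing.mul /GRing.scale /= qmulE !qscaleE qmulE scalerAr.
Qed.
HB.instance Definition _ := GRing.Lalgebra_isAlgebra.Build F algquot qscaleAr.

Lemma qclass_monoid : monoid_morphism qclass.
Proof. by split=> // x y; rewrite -qmulE. Qed.
HB.instance Definition _ :=
  GRing.isMonoidMorphism.Build A algquot qclass qclass_monoid.
Lemma qclass_scalable : scalable qclass.
Proof. by move=> c x; rewrite -qscaleE. Qed.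
HB.instance Definition _ :=
  GRing.isScalable.Build F A algquot *:%R qclass qclass_scalable.

End AlgQuotient.

(* F<a,b>, as the monoid algebra of the free monoid on two letters. *)
Section FreeAlgebra.
Variable F : fieldType.

Let M := {malg F[{fmonom 'I_2}]}.

Lemma malg_scaleAr (c : F) (x y : M) : c *: (x * y) = x * (c *: y).
Proof.
have comm (z : M) : malgC c * z = z * malgC c.
  rewrite [LHS]fgmulUg [RHS]fgmulgU; apply: eq_bigr => k _.
  by rewrite mulrC mul1m mulm1.
have -> : c *: y = malgC c * y by exact/esym/mul_malgC.
have -> : c *: (x * y) = malgC c * (x * y) by exact/esym/mul_malgC.
have -> : malgC c * (x * y) = malgC c * x * y by exact: mulrA.
by rewrite comm; exact/esym/mulrA.
Qed.

Definition freealg : Type := {malg F[{fmonom 'I_2}]}.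
HB.instance Definition _ := GRing.Lalgebra.on freealg.
HB.instance Definition _ :=
  GRing.Lalgebra_isAlgebra.Build F freealg malg_scaleAr.

End FreeAlgebra.

HB.lock Definition fa (F : fieldType) : freealg F := << fmu (0 : 'I_2) >>.
HB.lock Definition fb (F : fieldType) : freealg F := << fmu (1 : 'I_2) >>.

Section JordanOperation.
Variables (F : fieldType) (B : algType F).

Definition jprod (u v : B) : B := 2^-1 *: (u * v + v * u).
Definition omega (x y z : B) : B := x * jprod y z.

End JordanOperation.

(* The space A of 2 x 2 matrices with zero diagonal. *)
Section ZeroDiagonal.
Variable F : fieldType.

Definition zero_diag : {pred 'M[F]_2} :=
  [pred M : 'M[F]_2 | [forall i, M i i == 0]].

Lemma zero_diagP (M : 'M[F]_2) :
  reflect (forall i, M i i = 0) (M \in zero_diag).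
Proof. exact: 'forall_eqP. Qed.

Lemma zero_diag_submod : submod_closed zero_diag.
Proof.
split; first by apply/zero_diagP => i; rewrite mxE.
move=> c M N /zero_diagP M0 /zero_diagP N0; apply/zero_diagP => i.
by rewrite !mxE M0 N0 mulr0 addr0.
Qed.
HB.instance Definition _ :=
  GRing.isSubmodClosed.Build F 'M[F]_2 zero_diag zero_diag_submod.

Record zdmx := ZDMx { zdmx_val : 'M[F]_2; _ : zdmx_val \in zero_diag }.
HB.instance Definition _ := [isSub for zdmx_val].
HB.instance Definition _ := [Choice of zdmx by <:].
HB.instance Definition _ := [SubChoice_isSubLmodule of zdmx by <:].

Lemma omega_zero_diag (x y z : zdmx) :
  omega (val x) (val y) (val z) \in zero_diag.
Proof.
have cube (u v w : zdmx) : val u * (val v * val w) \in zero_diag.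
  case: u v w => [u /zero_diagP u0] [v /zero_diagP v0] [w /zero_diagP w0] /=.
  have ne2 (i j k l : 'I_2) : i != j -> j != k -> k != l -> l != i.
    by case: i j k l => [[|[|?]] ?] [[|[|?]] ?] [[|[|?]] ?] [[|[|?]] ?].
  apply/zero_diagP => i; rewrite mxE big1 // => j _.
  have [->|ij] := eqVneq i j; first by rewrite u0 mul0r.
  rewrite mxE big1 ?mulr0 // => k _.
  have [->|jk] := eqVneq j k; first by rewrite v0 mul0r.
  have [->|ki] := eqVneq k i; first by rewrite w0 mulr0.
  by have := ne2 _ _ _ _ ij jk ki; rewrite eqxx.
by rewrite /omega /jprod -scalerAr mulrDr rpredZ ?rpredD ?cube.
Qed.

Definition zd_omega (x y z : zdmx) : zdmx := ZDMx (omega_zero_diag x y z).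

Lemma e1_subproof : delta_mx 0 1 \in zero_diag.
Proof. by apply/zero_diagP => -[[|[|?]] ?]; rewrite mxE. Qed.
Lemma e2_subproof : delta_mx 1 0 \in zero_diag.
Proof. by apply/zero_diagP => -[[|[|?]] ?]; rewrite mxE. Qed.

Definition e1 : zdmx := ZDMx e1_subproof.
Definition e2 : zdmx := ZDMx e2_subproof.

End ZeroDiagonal.

HB.lock Definition phi (F : fieldType) (x : zdmx F) : freealg F :=
  val x 0 1 *: fa F + val x 1 0 *: fb F.

Section Phi.
Variable F : fieldType.
Local Notation zdmx := (zdmx F).
Local Notation phi := (@phi F).

Lemma phi_is_linear : linear phi.
Proof.
have lin2 (V : lmodType F) (v w : V) (c : F) (M N : 'M[F]_2) :
    (c *: M + N) 0 1 *: v + (c *: M + N) 1 0 *: w =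
    c *: (M 0 1 *: v + M 1 0 *: w) + (N 0 1 *: v + N 1 0 *: w).
  by rewrite !mxE !scalerDl scalerDr !scalerA addrACA.
by move=> c x y; rewrite phi.unlock; exact: (lin2 _ (fa F) (fb F) c (val x)).
Qed.
HB.instance Definition _ := GRing.isLinear.Build F zdmx (freealg F) *:%R phi
  phi_is_linear.

Lemma phi_e1 : phi (e1 F) = fa F.
Proof.
have lin (V : lmodType F) (v w : V) : (1 : F) *: v + (0 : F) *: w = v.
  by rewrite scale1r scale0r addr0.
by rewrite phi.unlock -[RHS](lin _ _ (fb F)) !mxE.
Qed.
Lemma phi_e2 : phi (e2 F) = fb F.
Proof.
have lin (V : lmodType F) (v w : V) : (0 : F) *: v + (1 : F) *: w = w.
  by rewrite scale1r scale0r add0r.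
by rewrite phi.unlock -[RHS](lin _ (fa F)) !mxE.
Qed.

End Phi.

Section Envelope.
Variable F : fieldType.

Definition relator (x y z : zdmx F) : freealg F :=
  omega (phi x) (phi y) (phi z) - phi (zd_omega x y z).

Definition two_sided_closed (J : freealg F -> Prop) : Prop :=
  [/\ J 0, forall u v, J u -> J v -> J (u - v)
    & forall x u y, J u -> J (x * u * y)].

Definition has_relators (J : freealg F -> Prop) : Prop :=
  forall x y z, x \in [:: e1 F; e2 F] -> y \in [:: e1 F; e2 F] ->
    z \in [:: e1 F; e2 F] -> J (relator x y z).

(* The intersection of all two-sided ideals (proper or not) containing the
   relators. *)
Definition rel_ideal : {pred freealg F} := fun u =>
  `[< forall J, two_sided_closed J -> has_relators J -> J u >].

Lemma rel_idealP u :
  reflect (forall J, two_sided_closed J -> has_relators J -> J u)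
          (u \in rel_ideal).
Proof. exact: asboolP. Qed.

(* The ideal is proper: the augmentation a, b |-> 0 kills the relators. *)
Definition augment (u : freealg F) : F :=
  @mcoeff {fmonom 'I_2} F mone u.

Lemma augment1 : augment 1 = 1.
Proof. exact: (@rmorph1 _ _ (@mcoeff {fmonom 'I_2} F mone)). Qed.
Lemma augmentB u v : augment (u - v) = augment u - augment v.
Proof. exact: (@mcoeffB {fmonom 'I_2} F). Qed.
Lemma augmentM u v : augment (u * v) = augment u * augment v.
Proof. exact: (@rmorphM _ _ (@mcoeff {fmonom 'I_2} F mone)). Qed.

Lemma augment_phi (x : zdmx F) : augment (phi x) = 0.
Proof.
pose eps := @mcoeff {fmonom 'I_2} F mone.
have fmu1 (i : 'I_2) : eps << fmu i >> = 0.
  rewrite /eps mcoeffU; case: eqP => // /(congr1 (@fmonom_val _)).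
  by rewrite fmuE fm1.
have lin (V : lmodType F) (g : V -> F) s t v w :
    {morph g : x y / x + y} -> (forall c x, g (c *: x) = c * g x) ->
    g v = 0 -> g w = 0 -> g (s *: v + t *: w) = 0.
  by move=> D Z v0 w0; rewrite D !Z v0 w0 !mulr0 addr0.
have D : {morph eps : u v / u + v} by exact: mcoeffD.
have Z c u : eps (c *: u) = c * eps u by exact: mcoeffZ.
rewrite phi.unlock fa.unlock fb.unlock.
exact: (lin _ eps _ _ _ _ D Z (fmu1 _) (fmu1 _)).
Qed.

Lemma rel_ideal_proper : 1 \notin rel_ideal.
Proof.
apply/negP => /rel_idealP /(_ (fun u => augment u = 0)) H.
suff /eqP : (1 : F) = 0 by rewrite oner_eq0.
rewrite -augment1; apply: H.
  split; first by rewrite -[X in augment X](subrr 1) augmentB subrr.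
    by move=> u v u0 v0; rewrite augmentB u0 v0 subr0.
  by move=> x u y u0; rewrite !augmentM u0 mulr0 mul0r.
move=> x y z _ _ _; rewrite /relator augmentB augment_phi subr0.
by rewrite augmentM augment_phi mul0r.
Qed.

Lemma rel_ideal_closed : idealr_closed rel_ideal.
Proof.
split; [by apply/rel_idealP => J [] | exact: rel_ideal_proper |].
move=> a u v /rel_idealP Ju /rel_idealP Jv; apply/rel_idealP => J clJ relJ.
have [J0 JB JM] := clJ; rewrite -[v]opprK; apply: (JB).
  by rewrite -[a * u]mulr1; apply: JM; exact: Ju.
by rewrite -sub0r; apply: JB => //; exact: Jv.
Qed.
HB.instance Definition _ :=
  isIdealr.Build (freealg F) rel_ideal rel_ideal_closed.

Lemma rel_ideal_right a : {in rel_ideal, forall u, u * a \in rel_ideal}.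
Proof.
move=> u /rel_idealP Ju; apply/rel_idealP => J clJ relJ; have [_ _ JM] := clJ.
by rewrite -[u]mul1r; apply: JM; exact: Ju.
Qed.
HB.instance Definition _ :=
  isRightStable.Build (freealg F) rel_ideal rel_ideal_right.

Definition U : Type := algquot (rel_ideal : ideal2 (freealg F)).
HB.instance Definition _ := GRing.Algebra.on U.

Definition ua : U := qclass (rel_ideal : ideal2 (freealg F)) (fa F).
Definition ub : U := qclass (rel_ideal : ideal2 (freealg F)) (fb F).

End Envelope.

Section LinearAlgebra.
Variables (F : fieldType) (V : lmodType F).

(* [v] is a basis of the subspace [P]; [V] need not be finite dimensional. *)
Definition is_basis (P : {pred V}) (n : nat) (v : n.-tuple V) : Prop :=
  [/\ forall i, tnth v i \in P,
      forall c : 'I_n -> F, \sum_i c i *: tnth v i = 0 -> forall i, c i = 0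
    & forall u, u \in P -> exists c : 'I_n -> F, u = \sum_i c i *: tnth v i].

Definition has_dim (P : {pred V}) (n : nat) : Prop :=
  exists v : n.-tuple V, is_basis P v.

Definition direct_decomp (P Q : {pred V}) : Prop :=
  forall u, exists! pq : V * V, [/\ pq.1 \in P, pq.2 \in Q & u = pq.1 + pq.2].

End LinearAlgebra.

Section Radical.
Variables (F : fieldType) (B : algType F).

(* J ^ n = 0 for some n, i.e. all products of n elements of J vanish. *)
Definition nilpotent_ideal (J : {pred B}) : Prop :=
  exists n : nat, forall s : n.-tuple B,
    {subset s <= J} -> \prod_(x <- s) x = 0.

(* The radical is the largest nilpotent two-sided ideal. Considering proper
   ideals only loses nothing, as a nilpotent ideal does not contain 1. *)
Definition is_radical (R : ideal2 B) : Prop :=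
  nilpotent_ideal R /\
  forall J : ideal2 B, nilpotent_ideal J ->
    {subset (J : {pred B}) <= (R : {pred B})}.

End Radical.

Section Representations.
Variables (F : fieldType) (B : algType F).

(* Finite dimensional representations. The composition is spelled out since
   the library's ring structures on ['End(V)] require V != 0. *)
Record frep := FRep {
  frep_space : vectType F;
  frep_map :> {linear B -> 'End(frep_space)};
  frep1 : frep_map 1 = \1%VF;
  frepM : forall u v, frep_map (u * v) = (frep_map u \o frep_map v)%VF
}.

Definition irreducible_rep (r : frep) : Prop :=
  fullv != 0%VS :> {vspace frep_space r} /\
  forall W : {vspace frep_space r},
    (forall u, (r u @: W <= W)%VS) -> W = 0%VS \/ W = fullv.

Definition rep_iso (r s : frep) : Prop :=
  exists f : 'Hom(frep_space r, frep_space s),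
    bijective f /\ forall u, (f \o r u = s u \o f)%VF.

End Representations.

(* The elements of the basis of U other than 1; e.g. [Maab] is a^2 b. *)
Inductive mono := Ma | Mb | Maa | Mab | Mba | Mbb | Maab | Mbab.

Section StructureConstants.
Variable F : fieldType.
Local Notation a := (ua F).
Local Notation b := (ub F).

Definition mono_val (m : mono) : U F :=
  match m with
  | Ma => a | Mb => b | Maa => a ^+ 2 | Mab => a * b | Mba => b * a
  | Mbb => b ^+ 2 | Maab => a ^+ 2 * b | Mbab => b * a * b
  end.

Definition U_basis : 9.-tuple (U F) :=
  [tuple 1; a; b; a ^+ 2; a * b; b * a; b ^+ 2; a ^+ 2 * b; b * a * b].

Definition mono_mul (x y : mono) : U F :=
  match x, y with
  | Ma, Ma => a ^+ 2
  | Ma, Mb => a * b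
  | Ma, Mab => a ^+ 2 * b
  | Ma, Mba => a - a ^+ 2 * b
  | Ma, Mbab => a * b
  | Mb, Ma => b * a
  | Mb, Mb => b ^+ 2
  | Mb, Mab => b * a * b
  | Mb, Mba => b - b * a * b
  | Mb, Mbab => b ^+ 2
  | Maa, Mb => a ^+ 2 * b
  | Maa, Mba => a ^+ 2
  | Maa, Mbab => a ^+ 2 * b
  | Mab, Ma => a - a ^+ 2 * b
  | Mab, Mab => a * b
  | Mba, Mb => b * a * b
  | Mba, Mba => b * a
  | Mba, Mbab => b * a * b
  | Mbb, Ma => b - b * a * b
  | Mbb, Mab => b ^+ 2
  | Maab, Ma => a ^+ 2
  | Maab, Mab => a ^+ 2 * b
  | Mbab, Ma => b * a
  | Mbab, Mab => b * a * b
  | _, _ => 0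
  end.

End StructureConstants.

(* Main.v *)
(** Write x = aba and y = bab. In the envelope xx = yy = 0, xyx = x and
    yxy = y, so that ab, x, y, ba are 2 x 2 matrix units, and e = 1 - ab - ba
    is the complementary idempotent. Further a = x + a^2b and b = y + b^2a,
    where a^2, a^2b, b^2, b^2a span an ideal N with eN = N and Ne = 0; hence
    N^2 = 0. The envelope maps onto F x M_2(F) by a |-> (0, E12), b |-> (0, E21)
    with kernel N, and the endomorphism a |-> x, b |-> y has kernel N and splits
    this quotient. The nine words are linearly independent because they are so
    in M_4(F), where the envelope acts by a |-> E13 + E34, b |-> E24 + E43.
    On an irreducible representation either some ev is nonzero, and it spans a
    subspace killed by a and b, or e acts by 0, hence so does N = eN, and for
    any nonzero w = abv the pair w, bw spans a subspace on which a and b act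
    as E12 and E21. *)

Require Import Defs.
From HB Require Import structures.
From mathcomp Require Import all_boot all_algebra.
From mathcomp Require Import boolp.
From mathcomp.multinomials Require Import monalg.

Set Implicit Arguments.
Unset Strict Implicit.
Unset Printing Implicit Defensive.

Import GRing.Theory.
Local Open Scope ring_scope.

(** * The universal property of a quotient algebra *)

Section QuotientLift.
Variables (F : fieldType) (A B : algType F) (I : ideal2 A).
Variables (h : {lrmorphism A -> B}).
Hypothesis hI : forall u, u \in (I : {pred A}) -> h u = 0.

(* The proof argument keeps the morphism structures below inferable. *)
Definition qlift of (forall u, u \in (I : {pred A}) -> h u = 0) :
  algquot I -> B := fun u => h (repr (u : Quotient.quot I)).
Local Notation lift := (qlift hI).

(** The chosen representative differs from [x] by an element of [I], which [h] kills. *)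
Lemma qliftE x : lift (qclass I x) = h x.
Proof.
apply/esym/eqP; rewrite -subr_eq0 -raddfB; apply/eqP/hI; exact: qclass_repr.
Qed.

Fact qlift_zmod_morphism : zmod_morphism lift.
Proof.
move=> u v; have [x ->] := qclass_surj u; have [y ->] := qclass_surj v.
by rewrite -raddfB !qliftE raddfB.
Qed.
HB.instance Definition _ :=
  GRing.isZmodMorphism.Build (algquot I) B lift qlift_zmod_morphism.

Fact qlift_monoid_morphism : monoid_morphism lift.
Proof.
split=> [|u v]; first by rewrite -(rmorph1 (qclass I)) qliftE rmorph1.
have [x ->] := qclass_surj u; have [y ->] := qclass_surj v.
by rewrite -rmorphM !qliftE rmorphM.
Qed.
HB.instance Definition _ :=
  GRing.isMonoidMorphism.Build (algquot I) B lift qlift_monoid_morphism.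

Fact qlift_scalable : scalable lift.
Proof.
by move=> c u; have [x ->] := qclass_surj u; rewrite -linearZ !qliftE linearZ.
Qed.
HB.instance Definition _ :=
  GRing.isScalable.Build F (algquot I) B *:%R lift qlift_scalable.

End QuotientLift.

(** * Kernels as proper two-sided ideals *)

Section Kernel.
Variables (F : fieldType) (A B : algType F) (h : {lrmorphism A -> B}).

Definition kernel : {pred A} := [pred u | h u == 0].

Lemma kernelP u : reflect (h u = 0) (u \in kernel).
Proof. exact: eqP. Qed.

Fact kernel_idealr : idealr_closed kernel.
Proof.
split; first by apply/kernelP; exact: raddf0.
  by apply/negP => /kernelP; rewrite rmorph1 => /eqP; rewrite oner_eq0.
move=> c u v /kernelP u0 /kernelP v0; apply/kernelP.
have -> : h (c * u + v) = h c * h u + h v by rewrite rmorphD rmorphM.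
by rewrite u0 v0 mulr0 addr0.
Qed.
HB.instance Definition _ := isIdealr.Build A kernel kernel_idealr.

Fact kernel_right (c : A) : {in kernel, forall u, u * c \in kernel}.
Proof.
move=> u /kernelP u0; apply/kernelP.
have -> : h (u * c) = h u * h c by rewrite rmorphM.
by rewrite u0 mul0r.
Qed.
HB.instance Definition _ := isRightStable.Build A kernel kernel_right.

End Kernel.

(** * Induction and evaluation in the free algebra *)

Section FreeAlgebra.
Variable F : fieldType.

(** Words arise from 1 by prefixing letters, and every element is a linear combination of words. *)
Lemma freealg_ind (P : freealg F -> Prop) :
    P 1 -> (forall c u v, P u -> P v -> P (c *: u + v)) ->
    (forall u, P u -> P (fa F * u)) -> (forall u, P u -> P (fb F * u)) ->
  forall u, P u.
Proof.
move=> P1 Plin Pa Pb.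
have P0 : P 0 by rewrite -(addNr 1) -scaleN1r; exact: Plin.
have Pw (w : {fmonom 'I_2}) : P << w >>.
  case: w => w; elim: w => [|i w Pw].
    have -> : FMonom [::] = mone :> {fmonom 'I_2}.
      by apply: val_inj; rewrite /= fm1.
    exact: P1.
  have -> : << FMonom (i :: w) >> = << fmu i >> * << FMonom w >> :> freealg F.
    apply: etrans (esym (fgmulUU _ _ _ _)); rewrite mulr1.
    by congr << _ *g _ >>; apply: val_inj; rewrite /= fmM fmU.
  case: i => [[|[|//]] i2].
    have -> : Ordinal i2 = 0 by exact: val_inj.
    by move: (Pa _ Pw); rewrite fa.unlock.
  have -> : Ordinal i2 = 1 by exact: val_inj.
  by move: (Pb _ Pw); rewrite fb.unlock.
(* The sum over the finite support is built up one word at a time. *)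
move=> u; rewrite (monalgE u).
elim: (finmap.enum_fset _) => [|k s IHs]; first by rewrite big_nil.
rewrite big_cons.
have -> : << u@_k *g k >> = u@_k *: (<< k >> : freealg F).
  apply/malgP => m; apply: etrans (esym (mcoeffZ _ _ _)).
  by rewrite !mcoeffU mulrnAr mulr1.
exact: Plin.
Qed.

Variables (B : algType F) (x y : B).

Definition word_eval (m : {fmonom 'I_2}) : B :=
  \prod_(i <- fmonom_val m) (if i == 0 then x else y).

Fact word_eval_mmorphism : mmorphism word_eval.
Proof.
by split=> [m n|]; rewrite /word_eval ?fmM ?fm1 ?big_cat ?big_nil.
Qed.
HB.instance Definition _ :=
  isMultiplicative.Build {fmonom 'I_2} B word_eval word_eval_mmorphism.

Definition fa_eval : freealg F -> B := mmap (in_alg B) word_eval.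

Fact fa_eval_zmod_morphism : zmod_morphism fa_eval.
Proof. exact: mmap_is_additive. Qed.
HB.instance Definition _ :=
  GRing.isZmodMorphism.Build (freealg F) B fa_eval fa_eval_zmod_morphism.

(** Scalars are central in [B], which makes evaluation multiplicative although [B] need not be
    commutative. *)
Fact fa_eval_monoid_morphism : monoid_morphism fa_eval.
Proof.
have comm (u : {malg F[{fmonom 'I_2}]}) m n :
    GRing.comm (in_alg B u@_m) (word_eval n).
  by rewrite /GRing.comm /= -scalerAl -scalerAr mul1r mulr1.
by have [fM f1] := commr_mmap_is_multiplicative comm; split.
Qed.
HB.instance Definition _ :=
  GRing.isMonoidMorphism.Build (freealg F) B fa_eval fa_eval_monoid_morphism.

Fact fa_eval_scalable : scalable fa_eval.
Proof.
move=> c u; apply: etrans (mulr_algl c (fa_eval u)).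
exact: (@mmapZ _ F B (in_alg B) word_eval).
Qed.
HB.instance Definition _ :=
  GRing.isScalable.Build F (freealg F) B *:%R fa_eval fa_eval_scalable.

Lemma fa_eval_fa : fa_eval (fa F) = x.
Proof.
by rewrite fa.unlock /fa_eval mmapU /= scale1r mul1r /word_eval fmU big_seq1.
Qed.

Lemma fa_eval_fb : fa_eval (fb F) = y.
Proof.
by rewrite fb.unlock /fa_eval mmapU /= scale1r mul1r /word_eval fmU big_seq1.
Qed.

End FreeAlgebra.

(** * The defining relations, evaluated at a pair of elements *)

Definition jordan_rel (F : fieldType) (B : algType F) (x y : B) : Prop :=
  [/\ x * (x * x) = 0 /\ y * (y * y) = 0, x * (y * y) = 0, y * (x * x) = 0,
      x * (x * y) + x * (y * x) = x & y * (x * y) + y * (y * x) = y].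

Lemma rmorph_omega (F : fieldType) (A B : algType F) (h : {lrmorphism A -> B}) :
  forall x y z, h (omega x y z) = omega (h x) (h y) (h z).
Proof.
move=> x y z; rewrite /omega /jprod.
by rewrite -!rmorphM -rmorphD -linearZ -rmorphM.
Qed.

Section Relators.
Variables (F : fieldType) (charF0 : [pchar F] =i pred0).

Lemma two_neq0 : 2 != 0 :> F.
Proof. by rewrite ((pcharf0P F).1 charF0). Qed.

(** With zero diagonals, only the alternating path 0, 1, 0, 1 contributes to this entry of a triple
    product. *)
Lemma zd_omega01 (u v w : zdmx F) : val (zd_omega u v w) 0 1 =
  val u 0 1 * (2^-1 * (val v 1 0 * val w 0 1 + val w 1 0 * val v 0 1)).
Proof.
have zd (m : zdmx F) i : val m i i = 0 by move: (valP m) => /zero_diagP.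
rewrite /= /omega /jprod !mxE !big_ord_recl big_ord0 /= !mxE.
rewrite !big_ord_recl !big_ord0 /=.
have -> : lift ord0 ord0 = 1 :> 'I_2 by exact: val_inj.
have -> : ord0 = 0 :> 'I_2 by exact: val_inj.
by rewrite !zd !(mul0r, mulr0, add0r, addr0).
Qed.

Lemma zd_omega10 (u v w : zdmx F) : val (zd_omega u v w) 1 0 =
  val u 1 0 * (2^-1 * (val v 0 1 * val w 1 0 + val w 0 1 * val v 1 0)).
Proof.
have zd (m : zdmx F) i : val m i i = 0 by move: (valP m) => /zero_diagP.
rewrite /= /omega /jprod !mxE !big_ord_recl big_ord0 /= !mxE.
rewrite !big_ord_recl !big_ord0 /=.
have -> : lift ord0 ord0 = 1 :> 'I_2 by exact: val_inj.
have -> : ord0 = 0 :> 'I_2 by exact: val_inj.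
by rewrite !zd !(mul0r, mulr0, add0r, addr0).
Qed.

Variables (B : algType F) (h : {lrmorphism freealg F -> B}).

Lemma lift_phi (u : zdmx F) :
  h (phi u) = val u 0 1 *: h (fa F) + val u 1 0 *: h (fb F).
Proof.
have lin (A : algType F) (g : {lrmorphism A -> B}) c d (x y : A) :
    g (c *: x + d *: y) = c *: g x + d *: g y by rewrite linearD !linearZ.
by rewrite phi.unlock lin.
Qed.

Lemma lift_relator (u v w : zdmx F) :
  h (relator u v w) =
  omega (h (phi u)) (h (phi v)) (h (phi w)) - h (phi (zd_omega u v w)).
Proof. by rewrite /relator raddfB /= rmorph_omega. Qed.

Lemma omega_eq (x y z t : B) :
  omega x y z = 2^-1 *: t <-> x * (y * z) + x * (z * y) = t.
Proof.
rewrite /omega /jprod -scalerAr -mulrDr; split=> [|-> //].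
by apply: scalerI; rewrite invr_neq0 ?two_neq0.
Qed.

(** The operation is symmetric in its last two arguments, so the eight triples of basis elements
    give six equations; with scalar factors cleared they are those of [jordan_rel]. *)
Lemma relatorsP :
  (forall u v w, u \in [:: e1 F; e2 F] -> v \in [:: e1 F; e2 F] ->
     w \in [:: e1 F; e2 F] -> h (relator u v w) = 0) <->
  jordan_rel (h (fa F)) (h (fb F)).
Proof.
have mem1 : e1 F \in [:: e1 F; e2 F] by rewrite inE eqxx.
have mem2 : e2 F \in [:: e1 F; e2 F] by rewrite !inE eqxx orbT.
have relE u v w : h (relator u v w) = 0 <->
  h (phi u) * (h (phi v) * h (phi w)) + h (phi u) * (h (phi w) * h (phi v)) =
  (val u 0 1 * (val v 1 0 * val w 0 1 + val w 1 0 * val v 0 1)) *: h (fa F) +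
  (val u 1 0 * (val v 0 1 * val w 1 0 + val w 0 1 * val v 1 0)) *: h (fb F).
  rewrite -omega_eq lift_relator [h (phi (zd_omega _ _ _))]lift_phi.
  rewrite zd_omega01 zd_omega10 ![_ * (2^-1 * _)]mulrCA -!scalerA -scalerDr.
  by split=> [/eqP|->]; rewrite ?subrr // subr_eq0 => /eqP.
(* When the last two arguments coincide, the cleared equation has the form z + z = 0. *)
have dbl (z : B) : z + z = 0 -> z = 0.
  move/eqP; rewrite -mulr2n -scaler_nat scaler_eq0 (negPf two_neq0).
  by move/eqP.
have v1 : (val (e1 F) 0 1 = 1) * (val (e1 F) 1 0 = 0) by rewrite !mxE.
have v2 : (val (e2 F) 0 1 = 0) * (val (e2 F) 1 0 = 1) by rewrite !mxE.
have p1 : h (phi (e1 F)) = h (fa F) by rewrite phi_e1.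
have p2 : h (phi (e2 F)) = h (fb F) by rewrite phi_e2.
have simp := (v1, v2, p1, p2, mul1r, mul0r, mulr0, mulr1, add0r, addr0,
  scale0r, scale1r).
split=> [rel|[[xxx yyy] xyy yxx ex ey] u v w].
  split; first split.
  - by have /relE := rel _ _ _ mem1 mem1 mem1; rewrite !simp => /dbl.
  - by have /relE := rel _ _ _ mem2 mem2 mem2; rewrite !simp => /dbl.
  - by have /relE := rel _ _ _ mem1 mem2 mem2; rewrite !simp => /dbl.
  - by have /relE := rel _ _ _ mem2 mem1 mem1; rewrite !simp => /dbl.
  - by have /relE := rel _ _ _ mem1 mem1 mem2; rewrite !simp.
  - by have /relE := rel _ _ _ mem2 mem1 mem2; rewrite !simp.
rewrite !inE => /orP[]/eqP-> /orP[]/eqP-> /orP[]/eqP->; apply/relE.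
all: rewrite !simp.
(* Commuting the sum handles the triples whose last two arguments are swapped. *)
all: by rewrite ?xxx ?yyy ?xyy ?yxx ?addr0 ?ex ?ey // addrC ?ex ?ey.
Qed.

End Relators.

(** * Rewriting in the envelope and its universal property *)

Section Envelope.
Variables (F : fieldType) (charF0 : [pchar F] =i pred0).

Local Notation a := (ua F).
Local Notation b := (ub F).

Lemma jordan_rel_U : jordan_rel a b.
Proof.
pose I : ideal2 (freealg F) := @rel_ideal F.
apply/(relatorsP charF0 (qclass I)) => u v w u12 v12 w12.
rewrite -(raddf0 (qclass I)); apply/qclassP; rewrite subr0.
by apply/rel_idealP => J _; exact.
Qed.

Lemma mul_aba : a * (b * a) = a - a * (a * b).
Proof.
case: jordan_rel_U => _ _ _ e _.
by apply/eqP; rewrite eq_sym subr_eq addrC; apply/eqP.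
Qed.

Lemma mul_bba : b * (b * a) = b - b * (a * b).
Proof.
case: jordan_rel_U => _ _ _ _ e.
by apply/eqP; rewrite eq_sym subr_eq addrC; apply/eqP.
Qed.

Lemma mul_aaa : a * (a * a) = 0. Proof. by case: jordan_rel_U => -[]. Qed.
Lemma mul_bbb : b * (b * b) = 0. Proof. by case: jordan_rel_U => -[]. Qed.
Lemma mul_abb : a * (b * b) = 0. Proof. by case: jordan_rel_U. Qed.
Lemma mul_baa : b * (a * a) = 0. Proof. by case: jordan_rel_U. Qed.

(** In a right-associated word, the left-hand side of a rule followed by further letters is not a
    subterm; this form of the rule matches there. *)
Let mul3 (u v w z : U F) :
  u * (v * w) = z -> forall t, u * (v * (w * t)) = z * t.
Proof. by move=> <- t; rewrite !mulrA. Qed.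

(* A confluent rewriting system on right-associated words, with normal forms
   the words of [U_basis]. *)
Definition U_rules :=
  (mul_aba, mul_bba, mul_aaa, mul_bbb, mul_abb, mul_baa,
   mul3 mul_aba, mul3 mul_bba, mul3 mul_aaa, mul3 mul_bbb, mul3 mul_abb,
   mul3 mul_baa).

Definition U_simp :=
  (U_rules, =^~ mulrA, (mulrBr, mulrBl),
   (mulr0, mul0r, subr0, sub0r, subrr, subKr, oppr0)).

Lemma U_ind (P : U F -> Prop) :
    P 1 -> (forall c u v, P u -> P v -> P (c *: u + v)) ->
    (forall u, P u -> P (ua F * u)) -> (forall u, P u -> P (ub F * u)) ->
  forall u, P u.
Proof.
move=> P1 Plin Pa Pb u.
have [x ->] := qclass_surj (u : algquot (@rel_ideal F : ideal2 (freealg F))).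
elim/freealg_ind: x => [|c x y Px Py|x Px|x Px].
- by rewrite rmorph1.
- by rewrite linearP; exact: Plin.
- by rewrite rmorphM; exact: Pa.
- by rewrite rmorphM; exact: Pb.
Qed.

(** The ideal is the smallest one containing the relators, so it lies in the kernel of the
    evaluation at [x] and [y], which therefore descends to the envelope. *)
Lemma env_lift (B : algType F) (x y : B) :
  jordan_rel x y ->
  exists h : {lrmorphism U F -> B}, h (ua F) = x /\ h (ub F) = y.
Proof.
move=> rel; pose h : {lrmorphism freealg F -> B} := fa_eval x y.
have hI u : u \in (@rel_ideal F : ideal2 (freealg F)) -> h u = 0.
  move/rel_idealP/(_ (fun w => h w = 0)); apply.
    split=> [|v w v0 w0|v w z w0]; first exact: raddf0.
      by rewrite raddfB /= v0 w0 subrr.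
    apply/kernelP/(@ideal2Mr _ (kernel h))/(@ideal2Ml _ (kernel h)).
    exact/kernelP.
  apply/(relatorsP charF0).
  by rewrite /h /= fa_eval_fa fa_eval_fb.
exists (qlift hI : {lrmorphism _ -> _}); split.
  exact: etrans (qliftE hI _) (fa_eval_fa x y).
exact: etrans (qliftE hI _) (fa_eval_fb x y).
Qed.

Lemma U_table (x y : mono) : mono_val F x * mono_val F y = mono_mul F x y.
Proof.
case: x; case: y; rewrite /mono_val /mono_mul ?expr2 //.
all: by rewrite ?U_simp.
Qed.

End Envelope.

(** * Spanning and linear independence of the nine words *)

Section Span.
Variables (F : fieldType) (V : lmodType F) (n : nat) (v : n.-tuple V).

Definition in_span (u : V) : Prop :=
  exists c : 'I_n -> F, u = \sum_i c i *: tnth v i.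

Lemma in_spanP k u w : in_span u -> in_span w -> in_span (k *: u + w).
Proof.
move=> [c ->] [d ->]; exists (fun i => k * c i + d i).
rewrite scaler_sumr -big_split; apply: eq_bigr => i _.
by rewrite scalerDl scalerA.
Qed.

Lemma in_span_nth x0 i : (i < n)%N -> in_span (nth x0 v i).
Proof.
move=> lt_in; exists (fun j => (j == Ordinal lt_in)%:R).
rewrite (bigD1 (Ordinal lt_in)) //= eqxx scale1r (tnth_nth x0) big1 ?addr0 //.
by move=> j /negPf->; rewrite scale0r.
Qed.

Lemma in_span0 : in_span 0.
Proof. by exists (fun=> 0); rewrite big1 // => i _; rewrite scale0r. Qed.

Lemma in_spanZ k u : in_span u -> in_span (k *: u).
Proof. by move=> su; rewrite -[_ *: _]addr0; exact: in_spanP in_span0. Qed.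

Lemma in_spanD u w : in_span u -> in_span w -> in_span (u + w).
Proof. by move=> su sw; rewrite -[u]scale1r; exact: in_spanP. Qed.

Lemma in_spanB u w : in_span u -> in_span w -> in_span (u - w).
Proof. by move=> su sw; rewrite addrC -scaleN1r; exact: in_spanP. Qed.

End Span.

Lemma big_ord9 (V : nmodType) (f : 'I_9 -> V) :
  \sum_i f i =
  f 0 + (f 1 + (f 2 + (f 3 + (f 4 + (f 5 + (f 6 + (f 7 + f 8))))))).
Proof.
rewrite !big_ord_recl big_ord0 addr0.
by do ![congr (_ + _)]; congr f; apply: val_inj.
Qed.

Lemma forall_ord9 (P : 'I_9 -> Prop) :
  P 0 -> P 1 -> P 2 -> P 3 -> P 4 -> P 5 -> P 6 -> P 7 -> P 8 -> forall i, P i.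
Proof.
move=> P0 P1 P2 P3 P4 P5 P6 P7 P8 i.
have E (k : 'I_9) : val k = val i -> P k -> P i by move=> /val_inj->.
case: i E => [[|[|[|[|[|[|[|[|[|//]]]]]]]]] ?] E.
- exact: (E 0). - exact: (E 1). - exact: (E 2).
- exact: (E 3). - exact: (E 4). - exact: (E 5).
- exact: (E 6). - exact: (E 7). - exact: (E 8).
Qed.

Section Basis.
Variables (F : fieldType) (charF0 : [pchar F] =i pred0).
Local Notation a := (ua F).
Local Notation b := (ub F).

(** The span contains 1, and rewriting to normal form shows it stable under left multiplication by a
    and b. *)
Lemma U_span u : in_span (U_basis F) u.
Proof.
pose S := in_span (U_basis F).
have mem i : (i < 9)%N -> S (nth 0 (U_basis F) i) by exact: in_span_nth.
have s1 : S 1 by exact: (mem 0).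
have sa : S a by exact: (mem 1).
have sb : S b by exact: (mem 2).
have saa : S (a * a) by rewrite -expr2; exact: (mem 3).
have sab : S (a * b) by exact: (mem 4).
have sba : S (b * a) by exact: (mem 5).
have sbb : S (b * b) by rewrite -expr2; exact: (mem 6).
have saab : S (a * (a * b)) by rewrite mulrA -expr2; exact: (mem 7).
have sbab : S (b * (a * b)) by rewrite mulrA; exact: (mem 8).
(* These two differences are the normal forms of aba and bba. *)
have sa_aab : S (a - a * (a * b)) := in_spanB sa saab.
have sb_bab : S (b - b * (a * b)) := in_spanB sb sbab.
have s0 : S 0 by exact: in_span0.
have step x : (forall i, S (x * tnth (U_basis F) i)) ->
    forall w, S w -> S (x * w).
  move=> Sx w [c ->]; rewrite mulr_sumr.
  apply: big_ind => // [|i _]; first exact: in_spanD.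
  rewrite -scalerAr; apply: in_spanZ; exact: Sx.
elim/U_ind: u => [|c u w|u|u] //; first exact: in_spanP.
- apply: step => i; rewrite (tnth_nth 0).
  case: i => [[|[|[|[|[|[|[|[|[|//]]]]]]]]] ?] /=;
    by rewrite ?expr2 ?mulr1 ?(U_simp charF0).
- apply: step => i; rewrite (tnth_nth 0).
  case: i => [[|[|[|[|[|[|[|[|[|//]]]]]]]]] ?] /=;
    by rewrite ?expr2 ?mulr1 ?(U_simp charF0).
Qed.

(* In the block form [[s I, X], [0, M]] of 4 x 4 matrices into 2 x 2 blocks,
   [s] and [M] are the semisimple part of U and [X] is its radical. *)
Lemma jordan_rel_mx4 :
  jordan_rel (delta_mx 0 2 + delta_mx 2 3 : 'M[F]_4)
             (delta_mx 1 3 + delta_mx 3 2).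
Proof.
split; first split.
all: rewrite -!mulmxE !(mulmxDl, mulmxDr) !mul_delta_mx_cond /=
  ?(mulr0n, mulr1n, addr0, add0r, mulmx0) ?mul_delta_mx_cond /=
  ?(mulr0n, mulr1n, addr0, add0r, mulmx0).
all: by rewrite // addrC.
Qed.

Lemma lift_sum (B : algType F) (h : {lrmorphism U F -> B}) (c : 'I_9 -> F) :
  let x := h a in let y := h b in
  h (\sum_i c i *: tnth (U_basis F) i) =
  c 0 *: 1 + (c 1 *: x + (c 2 *: y + (c 3 *: (x * x) + (c 4 *: (x * y) +
    (c 5 *: (y * x) + (c 6 *: (y * y) + (c 7 *: (x * x * y) +
    c 8 *: (y * x * y)))))))).
Proof.
rewrite big_ord9 !(tnth_nth 0) /= !raddfD /= !linearZ /= rmorph1.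
by rewrite !expr2 !rmorphM.
Qed.

Lemma U_free (c : 'I_9 -> F) :
  \sum_i c i *: tnth (U_basis F) i = 0 -> forall i, c i = 0.
Proof.
have [rho [rhoa rhob]] := env_lift charF0 jordan_rel_mx4.
move=> /(congr1 rho); rewrite raddf0 lift_sum rhoa rhob -!mulmxE.
rewrite !(mulmxDl, mulmxDr) !mul_delta_mx_cond /=.
rewrite ?(mulr0n, mulr1n, addr0, add0r, mulmx0, mul0mx).
rewrite ?mul_delta_mx_cond /= ?(mulr0n, mulr1n, addr0, add0r).
move=> M0; have {M0} M0 i j := congr1 (fun M : 'M[F]_4 => M i j) M0.
have simp := (mxE, (mulr0, mulr1, addr0, add0r)).
(* The entries are read in an order such that each involves one new coefficient, besides ones
   already known to vanish. *)
have c0 : c 0 = 0 by have := M0 0 0; rewrite /= !simp /= ?simp.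
have c1 : c 1 = 0 by have := M0 2 3; rewrite /= !simp /= ?simp.
have c2 : c 2 = 0 by have := M0 1 3; rewrite /= !simp /= ?simp.
have c3 : c 3 = 0 by have := M0 0 3; rewrite /= !simp /= ?simp.
have c4 : c 4 = 0 by have := M0 2 2; rewrite /= !simp /= ?simp c0 add0r.
have c5 : c 5 = 0 by have := M0 3 3; rewrite /= !simp /= ?simp c0 add0r.
have c6 : c 6 = 0 by have := M0 1 2; rewrite /= !simp /= ?simp.
have c7 : c 7 = 0 by have := M0 0 2; rewrite /= !simp /= ?simp c1 add0r.
have c8 : c 8 = 0 by have := M0 3 2; rewrite /= !simp /= ?simp c2 add0r.
exact: forall_ord9.
Qed.

Lemma U_basisP : is_basis (predT : {pred U F}) (U_basis F).
Proof.
split=> // [|u _]; [exact: U_free | exact: U_span].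
Qed.

End Basis.

(** * The radical and the semisimple quotient *)

Lemma big_ord4 (V : nmodType) (f : 'I_4 -> V) :
  \sum_i f i = f 0 + (f 1 + (f 2 + f 3)).
Proof.
rewrite !big_ord_recl big_ord0 addr0.
by do ![congr (_ + _)]; congr f; apply: val_inj.
Qed.

Lemma idem_expr (B : nzRingType) (p : B) n : p * p = p -> p ^+ n = 0 -> p = 0.
Proof.
move=> pp; case: n => [/eqP|n]; first by rewrite oner_eq0.
have -> // : p ^+ n.+1 = p.
by elim: n => // n IHn; rewrite exprS IHn.
Qed.

(** Factoring both matrix units through dimension 1 leaves the 1 x 1 matrix with entry [M i k] in
    the middle. *)
Lemma mul_delta_delta (R : comNzRingType) n (M : 'M[R]_n) (i j k l : 'I_n) :
  delta_mx j i *m M *m delta_mx k l = M i k *: delta_mx j l.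
Proof.
rewrite -(mul_delta_mx (0 : 'I_1) j i) -(mul_delta_mx (0 : 'I_1) k l).
rewrite !mulmxA -(mulmxA (delta_mx j _)) -rowE -(mulmxA (delta_mx j _)) -colE.
by rewrite [col _ _]mx11_scalar !mxE mul_mx_scalar -scalemxAl mul_delta_mx.
Qed.

Section Wedderburn.
Variables (F : fieldType) (charF0 : [pchar F] =i pred0).
Local Notation a := (ua F).
Local Notation b := (ub F).

(** The idempotent e complementary to ab + ba; the map to F x M_2(F) sends it to (1, 0). *)
Definition corner : U F := 1 - a * b - b * a.

Lemma jordan_rel0 (B : algType F) : jordan_rel (0 : B) 0.
Proof. by split; rewrite !mulr0 ?addr0. Qed.

Lemma jordan_rel_mx2 :
  jordan_rel (delta_mx 0 1 : 'M[F]_2) (delta_mx 1 0).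
Proof.
by split; first split; rewrite -!mulmxE !mul_delta_mx_cond /=
  ?(mulr0n, mulr1n, addr0, add0r, mulmx0) ?mul_delta_mx_cond /=
  ?(mulr0n, mulr1n, addr0, add0r, mulmx0).
Qed.

Lemma jordan_rel_pair (B C : algType F) (x y : B) (z t : C) :
  jordan_rel x y -> jordan_rel z t -> jordan_rel (x, z) (y, t).
Proof.
move=> [[r1 r2] r3 r4 r5 r6] [[s1 s2] s3 s4 s5 s6].
by split; first split; apply/pair_eqP; apply/andP; split; apply/eqP.
Qed.

(** The last entry is b^2a in normal form. *)
Definition rad_basis : 4.-tuple (U F) :=
  [tuple a * a; b * b; a * (a * b); b - b * (a * b)].

Lemma rad_free (c : 'I_4 -> F) :
  \sum_i c i *: tnth rad_basis i = 0 -> forall i, c i = 0.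
Proof.
(* Coordinates of the combination in [U_basis]: the element b - bab puts [c 3] at b and [- c 3] at
   bab. *)
pose d := [:: 0; 0; c 3; c 0; 0; 0; c 1; c 2; - c 3] => sum0.
have d0 (i : 'I_9) : d`_i = 0.
  apply: (U_free charF0 (c := fun i => d`_i)); apply: etrans sum0.
  rewrite big_ord9 big_ord4 !(tnth_nth 0) /= !scale0r !add0r scaleNr scalerBr.
  rewrite !expr2 !mulrA.
  by do 2![rewrite addrCA; congr (_ + _)]; rewrite addrCA.
have E (k j : 'I_4) : val k = val j -> c k = 0 -> c j = 0 by move=> /val_inj->.
case=> [[|[|[|[|//]]]] ?].
- exact: (E 0 _ _ (d0 3)).
- exact: (E 1 _ _ (d0 6)).
- exact: (E 2 _ _ (d0 7)).
- exact: (E 3 _ _ (d0 2)).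
Qed.

Section SemisimpleQuotient.
Variable g : {lrmorphism U F -> (F^o * 'M[F]_2)%type}.
Hypotheses (ga : g a = (0, delta_mx 0 1)) (gb : g b = (0, delta_mx 1 0)).
Local Notation R := (kernel g).

(** A right inverse of [g], not multiplicative since a^2 is nonzero: ab, a, b, ba lie over the
    matrix units and [corner] lies over (1, 0). *)
Definition g_section (w : F^o * 'M[F]_2) : U F :=
  (w.1 : F) *: corner + (w.2 0 0 *: (a * b) + w.2 0 1 *: a +
              w.2 1 0 *: b + w.2 1 1 *: (b * a)).

Lemma g_sectionK : cancel g_section g.
Proof.
move=> [l M]; rewrite /g_section /corner /= !raddfD /= !linearZ /=.
rewrite !raddfN /= rmorph1 !rmorphM ga gb.
apply: injective_projections; rewrite /= ga gb /=.
  rewrite !(mul0r, mulr0, scaler0, subr0, addr0); exact: mulr1.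
rewrite -!mulmxE !mul_delta_mx_cond /= ?(mulr0n, mulr1n).
apply/matrixP => i j; rewrite !mxE.
case: i j => [[|[|//]] i2] [[|[|//]] j2] /=.
all: rewrite !(mulr0, mulr1) ?(subr0, subrr) !(addr0, add0r).
all: by congr (M _ _); apply: val_inj.
Qed.

Lemma rad_span u : u \in R -> in_span rad_basis u.
Proof.
move=> /kernelP; have [c ->] := U_span charF0 u.
rewrite lift_sum ga gb => sum0.
have c0 : c 0 = 0.
  by have := congr1 fst sum0; rewrite /= !(mul0r, scaler0, addr0) => /eqP;
    rewrite scaler_eq0 oner_eq0 orbF => /eqP.
have := congr1 snd sum0; rewrite /= -!mulmxE !mul_delta_mx_cond /=.
rewrite ?(mulr0n, mulr1n, mul0mx) ?mul_delta_mx_cond /= ?(mulr0n, mulr1n).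
move=> /matrixP M0.
have simp := (mxE, (mulr0, mulr1, addr0, add0r)).
have c1 : c 1 = 0 by have := M0 0 1; rewrite /= !simp /= ?simp.
have c4 : c 4 = 0 by have := M0 0 0; rewrite /= !simp /= ?simp c0 add0r.
have c5 : c 5 = 0 by have := M0 1 1; rewrite /= !simp /= ?simp c0 add0r.
(* Both b and bab map to the unit E21, so only the sum of their coefficients must vanish. *)
have c8 : c 8 = - c 2.
  have := M0 1 0; rewrite /= !simp /= ?simp => /eqP.
  by rewrite addrC addr_eq0 => /eqP.
exists (fun i => [:: c 3; c 6; c 7; c 2]`_i).
rewrite big_ord9 big_ord4 !(tnth_nth 0) /=.
rewrite c0 c1 c4 c5 c8 !scale0r !expr2 scaleNr scalerBr !mulrA !add0r.
by do 2![rewrite addrCA; congr (_ + _)]; rewrite addrCA.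
Qed.

Lemma rad_basis_kernel i : tnth rad_basis i \in R.
Proof.
apply/kernelP; rewrite (tnth_nth 0).
have simp := (mulmx0, mul0mx, mulr0, mul0r, subr0, subrr).
case: i => [[|[|[|[|//]]]] ?] /=.
all: rewrite ?raddfB /= ?rmorphM.
all: by apply: injective_projections; rewrite /= ?(ga, gb) /= ?simp -?mulmxE
  ?mul_delta_mx_cond /= ?(mulr0n, mulr1n, simp) ?mul_delta_mx_cond /= ?simp.
Qed.

Lemma has_dim_rad : has_dim (R : {pred U F}) 4.
Proof.
exists rad_basis; split; [exact: rad_basis_kernel|exact: rad_free|].
exact: rad_span.
Qed.

Lemma corner_mulr u : u \in R -> corner * u = u.
Proof.
move/rad_span => [c ->]; rewrite mulr_sumr; apply: eq_bigr => i _.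
rewrite -scalerAr; congr (_ *: _); rewrite (tnth_nth 0) /corner.
case: i => [[|[|[|[|//]]]] ?] /=.
all: by rewrite !(mulrBl, mulrBr) !mul1r ?(U_simp charF0).
Qed.

Lemma corner_mull u : u \in R -> u * corner = 0.
Proof.
move/rad_span => [c ->]; rewrite mulr_suml big1 // => i _.
rewrite -scalerAl (tnth_nth 0) /corner.
case: i => [[|[|[|[|//]]]] ?] /=.
all: by rewrite !(mulrBl, mulrBr) !mulr1 ?(U_simp charF0) scaler0.
Qed.

(** Inserting e gives uv = u(ev) = (ue)v = 0. *)
Lemma rad_mul0 u v : u \in R -> v \in R -> u * v = 0.
Proof. by move=> uR /corner_mulr <-; rewrite mulrA corner_mull ?mul0r. Qed.

(** The kernel has square zero. Conversely, a nilpotent ideal has a nilpotent image under the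
    surjection [g], and F x M_2(F) has no nonzero nilpotent ideal. *)
Lemma rad_is_radical : is_radical (R : ideal2 (U F)).
Proof.
split.
  exists 2%N => -[[|u [|v [|//]]] //= i] /= sR.
  rewrite big_cons big_seq1; apply: rad_mul0; apply: sR; rewrite !inE eqxx //.
  by rewrite orbT.
move=> J [n nilJ] u uJ; apply/kernelP.
(* Each left multiple of [g u] is the image of an element of [J], hence nilpotent. *)
have nil w : (w * g u) ^+ n = 0.
  have uwJ : g_section w * u \in J by exact: ideal2Ml.
  have -> : w * g u = g (g_section w * u) by rewrite rmorphM /= g_sectionK.
  have := nilJ [tuple of nseq n (g_section w * u)].
  rewrite big_nseq iter_mulr_1 => wu0; rewrite -rmorphXn wu0 ?raddf0 //.
  by move=> x; rewrite mem_nseq => /andP[_ /eqP->].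
(* A suitable multiple of a nonzero [g u] is a nonzero idempotent. *)
case: (g u) nil => l M nil.
have l0 : l = 0.
  apply/eqP/negPn/negP => lN0.
  have /idem_expr/(_ (nil (l^-1, 0)))/(congr1 fst)/eqP :
    (l^-1, 0) * (l, M) * ((l^-1, 0) * (l, M)) = (l^-1, 0) * (l, M).
    by apply: injective_projections; rewrite /= ?mul0r // mulVf // mulr1.
  by rewrite /= mulVf // oner_eq0.
apply: injective_projections => //=; apply/matrixP => i j; rewrite [RHS]mxE.
apply/eqP/negPn/negP => MN0.
(* Idempotence of the product holds because E_ji M E_ji = M_ij E_ji. *)
pose w : F^o * 'M[F]_2 := (0, (M i j)^-1 *: delta_mx j i).
have /idem_expr/(_ (nil w))/(congr1 snd) :
    w * (l, M) * (w * (l, M)) = w * (l, M).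
  apply: injective_projections; rewrite /= ?mul0r //.
  rewrite -!mulmxE -!scalemxAl -scalemxAr -mulmxA [M *m _]mulmxA.
  rewrite [_ *m (_ *m M)]mulmxA [delta_mx j i *m (M *m _)]mulmxA.
  by rewrite mul_delta_delta -scalemxAl !scalerA mulfVK.
(* Multiplying the vanishing idempotent by E_ji on the right would give E_ji = 0. *)
move=> /= /(congr1 (mulmx^~ (delta_mx j i))); rewrite -mulmxE.
rewrite -!scalemxAl mul_delta_delta mul0mx scalerA mulVf // scale1r.
by move/matrixP/(_ j i)/eqP; rewrite !mxE !eqxx oner_eq0.
Qed.

End SemisimpleQuotient.

End Wedderburn.

(** * Splitting off the semisimple part *)

Lemma jordan_rel_matrix_units (F : fieldType) (B : algType F) (x y : B) :
  [/\ x * x = 0, y * y = 0, x * (y * x) = x & y * (x * y) = y] ->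
  jordan_rel x y.
Proof.
move=> [xx yy xyx yxy]; split; rewrite ?xyx ?yxy ?xx ?yy ?mulr0 //.
  by rewrite mulrA xx mul0r add0r.
by rewrite [y * (y * x)]mulrA yy mul0r addr0.
Qed.

Section Splitting.
Variables (F : fieldType) (charF0 : [pchar F] =i pred0).
Local Notation a := (ua F).
Local Notation b := (ub F).
Variable g : {lrmorphism U F -> (F^o * 'M[F]_2)%type}.
Hypotheses (ga : g a = (0, delta_mx 0 1)) (gb : g b = (0, delta_mx 1 0)).
Local Notation R := (kernel g : ideal2 (U F)).

Local Notation x := (a * (b * a)).
Local Notation y := (b * (a * b)).

Lemma matrix_unit_rules :
  [/\ x * x = 0, y * y = 0, x * (y * x) = x & y * (x * y) = y].
Proof. by split; rewrite ?(U_simp charF0). Qed.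

(** The inverse of the induced map is the class of [g_section]: u and [g_section (g u)] have the
    same image under [g], so they differ by an element of the kernel. *)
Lemma quot_rad_iso : exists q : {lrmorphism algquot R -> (F^o * 'M[F]_2)%type},
  bijective q.
Proof.
have gR u : u \in (R : {pred U F}) -> g u = 0 by move/kernelP.
pose q : {lrmorphism algquot R -> (F^o * 'M[F]_2)%type} := qlift gR.
have qE u : q (qclass R u) = g u by exact: qliftE.
have qK : cancel (fun w => qclass R (g_section w)) q.
  by move=> w; rewrite qE; exact: g_sectionK.
exists q, (fun w => qclass R (g_section w)) => // u.
have [v ->] := qclass_surj u; apply/qclassP/kernelP.
by rewrite raddfB /= qE g_sectionK // subrr.
Qed.

Lemma rad_splitting : exists S : {pred U F},
  [/\ GRing.subalg_closed S, direct_decomp (R : {pred U F}) S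
    & exists f : {lrmorphism algquot R -> U F},
        injective f /\ forall u : U F, u \in S <-> exists x, u = f x].
Proof.
have [xx yy xyx yxy] := matrix_unit_rules.
(* The endomorphism a |-> x, b |-> y; it turns out to be the projection onto the complement along
   [R]. *)
have [t [ta tb]] := env_lift charF0 (jordan_rel_matrix_units matrix_unit_rules).
have t_rad_basis i : t (tnth (rad_basis F) i) = 0.
  rewrite (tnth_nth 0); case: i => [[|[|[|[|//]]]] ?] /=.
  - by rewrite rmorphM /= ta.
  - by rewrite rmorphM /= tb.
  - by rewrite !rmorphM /= ta tb mulrA xx mul0r.
  - by rewrite raddfB /= !rmorphM /= ta tb yxy subrr.
have tR u : u \in (R : {pred U F}) -> t u = 0.
  move/(rad_span charF0 ga gb)=> [c ->]; rewrite linear_sum big1 // => i _.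
  by rewrite linearZ /= t_rad_basis scaler0.
(* Both a - x = a^2b and b - y lie in the kernel of [g], whence [g] is unchanged by [t]. *)
have gx : g x = g a.
  have /kernelP ker2 := rad_basis_kernel ga gb 2.
  by rewrite (mul_aba charF0) raddfB /= ker2 subr0.
have gy : g y = g b.
  have /kernelP/eqP := rad_basis_kernel ga gb 3.
  by rewrite raddfB subr_eq0 => /eqP.
have gt u : g (t u) = g u.
  elim/U_ind: u => [|c u v gu gv|u gu|u gu].
  - by rewrite !rmorph1.
  - by rewrite !linearP /= gu gv.
  - by rewrite !rmorphM /= gu ta gx.
  - by rewrite !rmorphM /= gu tb gy.
(* The difference of [t u] and u lies in [R], which [t] kills. *)
have tt u : t (t u) = t u.
  apply/eqP; rewrite -subr_eq0 -raddfB; apply/eqP/tR/kernelP.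
  by rewrite raddfB /= gt subrr.
(* As [t] is idempotent, its fixed points form its image. *)
pose S : {pred U F} := [pred u | t u == u].
have SP u : reflect (t u = u) (u \in S) by exact: eqP.
exists S; split.
- split; first by apply/SP; rewrite rmorph1.
    by move=> c u v /SP tu /SP tv; apply/SP; rewrite linearP /= tu tv.
  by move=> u v /SP tu /SP tv; apply/SP; rewrite rmorphM /= tu tv.
- move=> u; exists (u - t u, t u); split=> /=.
    split; last by rewrite subrK.
      by apply/kernelP; rewrite raddfB /= gt subrr.
    exact/SP.
  move=> [p q] /= [pR /SP tq ->].
  by rewrite raddfD /= tR // add0r tq addrK.
(* The map [t] factors through the quotient, injectively because [t u] determines [g u]. *)
pose f : {lrmorphism algquot R -> U F} := qlift tR.
have fE u : f (qclass R u) = t u by exact: qliftE.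
exists f; split=> [u v|u].
  have [x ->] := qclass_surj u; have [y ->] := qclass_surj v.
  rewrite !fE => txy; apply/qclassP/kernelP.
  by rewrite raddfB /= -gt txy gt subrr.
split=> [/SP tu|[x ->]]; first by exists (qclass R u); rewrite fE.
by apply/SP; have [v ->] := qclass_surj x; rewrite fE.
Qed.

End Splitting.

(** * Intertwiners between irreducible representations *)

Section Schur.
Variables (F : fieldType) (B : algType F).

Lemma rep_iso_sym (r s : frep B) : rep_iso r s -> rep_iso s r.
Proof.
move=> [f [f_bij fr]]; have kf : lker f == 0%VS by apply/lker0P/bij_inj.
have fK : cancel f f^-1%VF by exact: lker0_lfunK.
have Kf : cancel f^-1%VF f.
  by move=> v; have [f' _ f'K] := f_bij; rewrite -(f'K v) fK.
exists (f^-1)%VF; split; first by exists f.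
move=> u; apply/lfunP => v; rewrite !comp_lfunE; apply: (can_inj fK).
by rewrite Kf -[RHS]comp_lfunE fr comp_lfunE Kf.
Qed.

(** The kernel and the image of an intertwiner are stable subspaces, so irreducibility makes a
    nonzero one injective and surjective. *)
Lemma schur (r s : frep B) (f : 'Hom(frep_space r, frep_space s)) :
  irreducible_rep r -> irreducible_rep s ->
  (forall u, (f \o r u = s u \o f)%VF) -> f != 0 -> rep_iso r s.
Proof.
move=> [_ irr] [_ irs] fr fN0.
have frE u v : f (r u v) = s u (f v) by rewrite -!comp_lfunE fr.
exists f; split=> //.
have kf : lker f = 0%VS.
  case: (irr (lker f)) => // [u|kf].
    apply/subvP => _ /memv_imgP[v + ->]; rewrite !memv_ker frE => /eqP->.
    by rewrite linear0.
  case/eqP: fN0; apply/lfunP => v; rewrite lfunE /=; apply/eqP.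
  by rewrite -memv_ker kf memvf.
have imf : limg f = fullv.
  case: (irs (limg f)) => // [u|imf].
    apply/subvP => _ /memv_imgP[_ /memv_imgP[v _ ->] ->].
    by rewrite -frE memv_img ?memvf.
  case/eqP: fN0; apply/lfunP => v; rewrite lfunE /=; apply/eqP.
  by rewrite -memv0 -imf memv_img ?memvf.
exists (f^-1)%VF; first by apply: lker0_lfunK; rewrite kf.
by move=> v; apply: limg_lfunVK; rewrite imf memvf.
Qed.

End Schur.

(** * Representations on column spaces and linear maps out of them *)

Section MatrixRep.
Variables (F : fieldType) (B : algType F) (n : nat).
Variable h : {lrmorphism B -> 'M[F]_n.+1}.

Definition mx_act (u : B) : 'End('cV[F]_n.+1) := linfun (mulmx (h u)).

Lemma mx_actE u v : mx_act u v = h u *m v.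
Proof. by rewrite lfunE. Qed.

Fact mx_act_linear : linear mx_act.
Proof.
move=> c u v; apply/lfunP => w; rewrite add_lfunE scale_lfunE !mx_actE.
by rewrite linearP /= mulmxDl -scalemxAl.
Qed.
HB.instance Definition _ :=
  GRing.isLinear.Build F B 'End('cV[F]_n.+1) *:%R mx_act mx_act_linear.

Fact mx_act1 : mx_act 1 = \1%VF.
Proof. by apply/lfunP => v; rewrite mx_actE rmorph1 mul1mx lfunE. Qed.

Fact mx_actM u v : mx_act (u * v) = (mx_act u \o mx_act v)%VF.
Proof.
by apply/lfunP => w; rewrite comp_lfunE !mx_actE rmorphM /= -mulmxE mulmxA.
Qed.

Definition mx_rep : frep B := FRep (frep_map := mx_act) mx_act1 mx_actM.

(** A nonzero vector of a stable subspace has a nonzero coordinate, and matrix units move it to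
    every standard column. *)
Lemma mx_rep_irreducible :
  (forall M, exists u, h u = M) -> irreducible_rep mx_rep.
Proof.
move=> h_surj; split.
  apply/eqP => full0.
  have : (const_mx 1 : 'cV[F]_n.+1) \in 0%VS by rewrite -full0 memvf.
  by rewrite memv0 => /eqP/matrixP/(_ 0 0)/eqP; rewrite !mxE oner_eq0.
move=> /= W stabW; have [W0|WN0] := eqVneq W 0%VS; [by left | right].
have [i vi] : exists i, vpick W i 0 != 0.
  apply/existsP; apply: contraR WN0 => /existsPn v0; rewrite -vpick0.
  apply/eqP/matrixP => i j; rewrite ord1 [RHS]mxE; apply/eqP.
  by have := v0 i; rewrite negbK.
have deltaW j : delta_mx j 0 \in W.
  have [u hu] := h_surj ((vpick W i 0)^-1 *: delta_mx j i).
  have -> : delta_mx j 0 = mx_act u (vpick W) :> 'cV[F]_n.+1.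
    rewrite mx_actE hu -scalemxAl; apply/matrixP => k l.
    rewrite !mxE (bigD1 i) //= big1 => [|p pi].
      by rewrite !mxE eqxx ord1 eqxx !andbT addr0 mulrCA mulVf // mulr1.
    by rewrite mxE (negPf pi) andbF mul0r.
  by apply: (subvP (stabW u)); rewrite memv_img ?memv_pick.
apply/vspaceP => v; rewrite memvf.
rewrite (matrix_sum_delta v) rpred_sum // => k _.
by rewrite big_ord1 rpredZ.
Qed.

End MatrixRep.

Section ColumnCombination.
Variables (F : fieldType) (V : vectType F) (n : nat) (w : 'I_n -> V).

(** The linear map sending the i-th standard column to [w i]; it supplies the intertwiners used for
    the classification. *)
Definition col_comb (c : 'cV[F]_n) : V := \sum_i c i 0 *: w i.

Fact col_comb_linear : linear col_comb.
Proof.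
move=> k c d; rewrite /col_comb scaler_sumr -big_split; apply: eq_bigr => i _.
by rewrite !mxE scalerDl scalerA.
Qed.
HB.instance Definition _ :=
  GRing.isLinear.Build F 'cV[F]_n V *:%R col_comb col_comb_linear.

Lemma col_comb_neq0 i : w i != 0 -> linfun col_comb != 0.
Proof.
apply: contraNneq => /lfunP/(_ (delta_mx i 0)).
rewrite zero_lfunE lfunE /= /col_comb (bigD1 i) //= mxE !eqxx scale1r big1.
  by rewrite addr0 => ->.
by move=> j ji; rewrite mxE (negPf ji) scale0r.
Qed.

End ColumnCombination.

(** * Classification of the irreducible representations *)

Section Classification.
Variables (F : fieldType) (charF0 : [pchar F] =i pred0).
Local Notation a := (ua F).
Local Notation b := (ub F).

(** Commuting with a and b is enough, since these generate the envelope. *)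
Lemma mx_intertwine n (h : {lrmorphism U F -> 'M[F]_n.+1}) (r : frep (U F))
    (f : 'Hom('cV[F]_n.+1, frep_space r)) :
  (forall c, f (h a *m c) = r a (f c)) ->
  (forall c, f (h b *m c) = r b (f c)) ->
  forall u, (f \o mx_act h u = r u \o f)%VF.
Proof.
move=> f_a f_b u.
suff fu c : f (h u *m c) = r u (f c).
  by apply/lfunP => c; rewrite !comp_lfunE mx_actE.
elim/U_ind: u c => [|k u v fu fv|u fu|u fu] c.
- by rewrite rmorph1 mul1mx frep1 id_lfunE.
- rewrite !linearP /= mulmxDl -scalemxAl linearP /= fu fv.
  by rewrite add_lfunE scale_lfunE.
- by rewrite rmorphM /= -mulmxE -mulmxA f_a fu frepM comp_lfunE.
- by rewrite rmorphM /= -mulmxE -mulmxA f_b fu frepM comp_lfunE.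
Qed.

Lemma irreducible_classification (h1 : {lrmorphism U F -> 'M[F]_1})
    (h2 : {lrmorphism U F -> 'M[F]_2}) :
    h1 a = 0 -> h1 b = 0 -> h2 a = delta_mx 0 1 -> h2 b = delta_mx 1 0 ->
    irreducible_rep (mx_rep h1) -> irreducible_rep (mx_rep h2) ->
  forall r : frep (U F), irreducible_rep r ->
    rep_iso r (mx_rep h1) \/ rep_iso r (mx_rep h2).
Proof.
move=> h1a h1b h2a h2b irr1 irr2 r irr.
have rM u v w : r u (r v w) = r (u * v) w by rewrite frepM comp_lfunE.
case: (eqVneq (r (corner F)) 0) => [re0|reN0]; [right|left].
  (* The elements b^2 and a^2b lie in eN, so they act by 0. *)
  have b2 : b * b = corner F * (b * b).
    by rewrite /corner !mulrBl !mul1r ?(U_simp charF0).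
  have a2b : a * (a * b) = corner F * (a * (a * b)).
    by rewrite /corner !mulrBl !mul1r ?(U_simp charF0).
  have rb2 w : r (b * b) w = 0 by rewrite b2 -rM re0 zero_lfunE.
  have ra2b w : r (a * (a * b)) w = 0 by rewrite a2b -rM re0 zero_lfunE.
  (* If ab acted by 0, then so would ba = b(ab)a, and with e every v = ev + abv + bav would
     vanish. *)
  have [v rv] : exists v, r (a * b) v != 0.
    apply: contrapT => ab0; have {}ab0 v : r (a * b) v = 0.
      by apply/eqP/negPn/negP => vN0; apply: ab0; exists v.
    have [/eqP[]] := irr; apply/vspaceP => v.
    rewrite memvf memv0; apply/esym/eqP.
    have : r (corner F) v = 0 by rewrite re0 zero_lfunE.
    rewrite /corner !raddfB /= !add_lfunE !opp_lfunE ab0 subr0 frep1 id_lfunE.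
    move/eqP; rewrite subr_eq0 => /eqP ->.
    have -> : b * a = b * ((a * b) * a) by rewrite ?(U_simp charF0).
    by rewrite -rM -rM ab0 linear0.
  apply/rep_iso_sym; set w := r (a * b) v in rv.
  pose f := linfun (col_comb (fun i : 'I_2 => if i == 0 then w else r b w)).
  apply: (@schur _ _ (mx_rep h2) r f) => //.
    (* On the pair w, bw: aw = a^2bv = 0, abw = ababv = w and b(bw) = b^2w = 0. *)
    have raw : r a w = 0 by rewrite rM.
    have rabw : r a (r b w) = w by rewrite !rM ?(U_simp charF0).
    have rbbw : r b (r b w) = 0 by rewrite rM.
    by apply: mx_intertwine => c; rewrite !lfunE /= /col_comb !big_ord_recl
      !big_ord0 ?(h2a, h2b) /= !addr0 !linearD !linearZ /= ?raw ?rabw ?rbbw !mxE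
      !big_ord_recl !big_ord0 !mxE /= ?(mul0r, mul1r, add0r, addr0, scale0r,
      scaler0).
  exact: (@col_comb_neq0 _ _ _ _ 0).
have [v rv] : exists v, r (corner F) v != 0.
  apply: contrapT => e0; case/eqP: reN0; apply/lfunP => v; rewrite zero_lfunE.
  by apply/eqP/negPn/negP => vN0; apply: e0; exists v.
apply/rep_iso_sym.
pose f := linfun (col_comb (fun i : 'I_1 => r (corner F) v)).
apply: (@schur _ _ (mx_rep h1) r f) => //.
  (* Since ae = be = 0, both generators kill ev. *)
  have r_corner u : u * corner F = 0 -> r u (r (corner F) v) = 0.
    by move=> u0; rewrite rM u0 linear0 zero_lfunE.
  have fE c : f c = c 0 0 *: r (corner F) v.
    by rewrite lfunE /= /col_comb big_ord1.
  apply: mx_intertwine => c; rewrite ?(h1a, h1b) mul0mx linear0 fE linearZ /=.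
    by rewrite r_corner ?scaler0 // /corner !mulrBr mulr1 ?(U_simp charF0).
  by rewrite r_corner ?scaler0 // /corner !mulrBr mulr1 ?(U_simp charF0).
exact: (@col_comb_neq0 _ _ _ _ 0).
Qed.

End Classification.

Section TwoIrreducibles.
Variables (F : fieldType) (charF0 : [pchar F] =i pred0).
Local Notation a := (ua F).
Local Notation b := (ub F).

Lemma mx1_surj (h : {lrmorphism U F -> 'M[F]_1}) M : exists u, h u = M.
Proof.
by exists (M 0 0)%:A; rewrite linearZ /= rmorph1 [RHS]mx11_scalar scalemx1.
Qed.

Lemma mx2_surj (h : {lrmorphism U F -> 'M[F]_2}) :
  h a = delta_mx 0 1 -> h b = delta_mx 1 0 -> forall M, exists u, h u = M.
Proof.
move=> ha hb M.
exists (M 0 0 *: (a * b) + M 0 1 *: a + M 1 0 *: b + M 1 1 *: (b * a)).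
rewrite !raddfD /= !linearZ /= !rmorphM /= ha hb -!mulmxE !mul_delta_mx.
apply/matrixP => i j; rewrite !mxE.
case: i j => [[|[|//]] i2] [[|[|//]] j2] /=.
all: rewrite !(mulr0, mulr1) !(addr0, add0r).
all: by congr (M _ _); apply: val_inj.
Qed.

Lemma two_irreducibles : exists r1 r2 : frep (U F),
  [/\ irreducible_rep r1, irreducible_rep r2, ~ rep_iso r1 r2
    & forall r : frep (U F), irreducible_rep r ->
        rep_iso r r1 \/ rep_iso r r2].
Proof.
have [h1 [h1a h1b]] := env_lift charF0 (jordan_rel0 'M[F]_1).
have [h2 [h2a h2b]] := env_lift charF0 (jordan_rel_mx2 F).
have irr1 : irreducible_rep (mx_rep h1) := mx_rep_irreducible (mx1_surj h1).
have irr2 : irreducible_rep (mx_rep h2).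
  exact: mx_rep_irreducible (mx2_surj h2a h2b).
exists (mx_rep h1), (mx_rep h2); split=> //; last first.
  exact: irreducible_classification.
(* An isomorphism is excluded because a acts by 0 on the first space but sends the second standard
   column of the other to the first. *)
case=> f [[f' _ f'K] /(_ a)/lfunP/(_ (f' (delta_mx 1 0)))].
rewrite !comp_lfunE !mx_actE h1a h2a mul0mx linear0 f'K mul_delta_mx.
by move/esym/matrixP/(_ 0 0)/eqP; rewrite !mxE oner_eq0.
Qed.

End TwoIrreducibles.

Theorem theorem5p4 (F : fieldType) (charF0 : [pchar F] =i pred0) :
  [/\ is_basis (predT : {pred U F}) (U_basis F),
      (forall x y : mono, mono_val F x * mono_val F y = mono_mul F x y),
      (exists R : ideal2 (U F),
        [/\ is_radical R,
            has_dim (R : {pred U F}) 4,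
            (exists S : {pred U F},
              [/\ GRing.subalg_closed S,
                  direct_decomp (R : {pred U F}) S
                & exists f : {lrmorphism algquot R -> U F},
                    injective f /\
                    forall u : U F, u \in S <-> exists x, u = f x])
          & exists g : {lrmorphism algquot R -> (F^o * 'M[F]_2)%type},
              bijective g])
    & exists r1 r2 : frep (U F),
        [/\ irreducible_rep r1, irreducible_rep r2, ~ rep_iso r1 r2
          & forall r : frep (U F), irreducible_rep r ->
              rep_iso r r1 \/ rep_iso r r2]].
Proof.
(* The map a |-> (0, E12), b |-> (0, E21), whose kernel is the radical. *)
have [g [ga gb]] := env_lift charF0
  (jordan_rel_pair (@jordan_rel0 F F^o) (jordan_rel_mx2 F)).
split; [exact: U_basisP | exact: U_table | | exact: two_irreducibles].
exists (kernel g); split.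
- exact: rad_is_radical.
- exact: has_dim_rad.
- exact: rad_splitting ga gb.
- exact: quot_rad_iso ga gb.
Qed.
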